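(* Let $q\in\mathbb{R}$ with $|q|>1$ and $n\ge1$. Let $\mathcal H$ be the common Hilbert space of the representations $\psi^{(2n)}_+$ and $\psi^{(2n)}_-$ of $A(S^{2n}_q)$. Let $\psi=\psi^{(2n)}_+\oplus\psi^{(2n)}_-$ act on $\mathcal H\oplus\mathcal H$, and put $$\gamma=\begin{pmatrix}1&0\\0&-1\end{pmatrix},\qquad F=\begin{pmatrix}0&1\\1&0\end{pmatrix}.$$ Then $(\mathcal H\oplus\mathcal H,F,\gamma)$ with the representation $\psi$ is an even $1$-summable Fredholm module over $A(S^{2n}_q)$. In particular, for every $a\in A(S^{2n}_q)$ the commutator $[F,\psi(a)]$ is trace class.
   Context: The $*$-algebra $A(S^{2n}_q)$ is the unital complex $*$-algebra generated by $x_0=x_0^*$, $x_i,x_i^*$ ($i=1,\dots,n$) with relations $$x_ix_j=q\,x_jx_i\ (0\le i<j\le n),\quad x_i^*x_j=q\,x_jx_i^*\ (i\neq j),\quad [x_i,x_i^*]=(1-q^{-2})s_{i-1}\ (1\le i\le n),\quad s_n=1,$$ where $s_0:=x_0^2$ and $s_i:=s_{i-1}+x_i^*x_i$. The $*$-representations $\psi^{(2n)}_\pm$ act on the Hilbert space $\mathcal H$ with orthonormal basis $\{|k_0,\dots,k_{n-1}\rangle:k_i\in\mathbb{Z}_{\ge0}\}$ by $$\psi^{(2n)}_\pm(x_0)|k_0,\dots,k_{n-1}\rangle=\pm q^{-(k_0+\dots+k_{n-1})}|k_0,\dots,k_{n-1}\rangle,$$ $$\psi^{(2n)}_\pm(x_i)|k_0,\dots,k_{n-1}\rangle=(1-q^{-2k_{i-1}})^{1/2}q^{-(k_i+\dots+k_{n-1})}|k_0,\dots,k_{i-1}-1,\dots,k_{n-1}\rangle,\quad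 i=1,\dots,n,$$ with $\psi^{(2n)}_\pm(x_i^* )=\psi^{(2n)}_\pm(x_i)^*$. An even $1$-summable Fredholm module over a $*$-algebra $A$ is a $*$-representation $\psi$ of $A$ on a Hilbert space, together with a grading operator $\gamma$ ($\gamma=\gamma^*$, $\gamma^2=1$) commuting with $\psi(A)$ and a self-adjoint operator $F$ with $F^2=1$ and $F\gamma=-\gamma F$, such that $[F,\psi(a)]$ is trace class for all $a\in A$. *)

(* Defs.v *)
From HB Require Import structures.
From mathcomp Require Import all_boot all_order all_algebra.
From mathcomp Require Import sesquilinear generic_quotient complex.
From mathcomp Require Import boolp classical_sets reals ereal esum.

Set Implicit Arguments.
Unset Strict Implicit.
Unset Printing Implicit Defensive.

Import Order.TTheory GRing.Theory Num.Theory.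
Local Open Scope ring_scope.
Local Open Scope complex_scope.
Local Open Scope quotient_scope.

(* Inner products are linear in the first argument. *)
Definition form_norm (R : rcfType) (H : lmodType R[i]) (d : H -> H -> R[i])
  (u : H) : R := Num.sqrt (complex.Re (d u u)).

Definition form_complete (R : rcfType) (H : lmodType R[i])
    (d : H -> H -> R[i]) : Prop :=
  forall u : nat -> H,
    (forall eps : R, 0 < eps -> exists N : nat, forall m p : nat,
        (N <= m)%N -> (N <= p)%N -> form_norm d (u m - u p) < eps) ->
    exists l : H, forall eps : R, 0 < eps -> exists N : nat, forall m : nat,
        (N <= m)%N -> form_norm d (u m - l) < eps.

HB.mixin Record isHilbert (R : rcfType) H of GRing.Lmodule R[i] H := {
  hdot : {dot H for @conjc R};
  hdot_complete : form_complete hdot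
}.

#[short(type="hilbertType")]
HB.structure Definition Hilbert (R : rcfType) :=
  {H of GRing.Lmodule R[i] H & isHilbert R H}.

Notation "''[' u , v ]" := (hdot u v) : ring_scope.

Definition hnorm (R : rcfType) (H : hilbertType R) (u : H) : R :=
  form_norm hdot u.

(* The Hilbert direct sum, carried by the product module. *)
Section DirectSum.
Variables (R : rcfType) (H K : hilbertType R).

Definition sum_dot (u v : H * K) : R[i] := '[u.1, v.1] + '[u.2, v.2].

Fact sum_dot_bilinear :
  bilinear_for *%R (@conjc R \; *%R) sum_dot.
Proof.
split=> [v|u] a x y; rewrite /sum_dot /=.
  by rewrite !linearDl !linearZl_LR /= mulrDr addrACA.
by rewrite !linearDr !linearZr_LR /= mulrDr addrACA.
Qed.

HB.instance Definition _ := bilinear_isBilinear.Build R[i] (H * K)%type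
  (H * K)%type R[i] *%R (@conjc R \; *%R) sum_dot sum_dot_bilinear.

Fact sum_dot_hermitian (u v : H * K) :
  sum_dot u v = (-1) ^+ false * conjc (sum_dot v u).
Proof.
rewrite /sum_dot expr0 mul1r rmorphD /=.
by congr (_ + _); rewrite [LHS]hermC expr0 mul1r.
Qed.

HB.instance Definition _ := isHermitianSesquilinear.Build R[i] (H * K)%type
  false (@conjc R) sum_dot sum_dot_hermitian.

Let dot_ge0 (L : hilbertType R) (w : L) : 0 <= '[w, w].
Proof.
have [->|w0] := eqVneq w 0; first by rewrite linear0l.
exact: ltW (neq0_dnorm_gt0 w w0).
Qed.

Fact sum_dot_gt0 (u : H * K) : u != 0 -> 0 < sum_dot u u.
Proof.
case: u => u v; rewrite /sum_dot /= => uv0.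
have [u0|u0] := eqVneq u 0.
  have v0 : v != 0.
    by apply: contra uv0 => /eqP ->; rewrite u0; apply/eqP.
  by rewrite ltr_wpDl ?dot_ge0// neq0_dnorm_gt0.
by rewrite ltr_pwDl ?dot_ge0// neq0_dnorm_gt0.
Qed.

HB.instance Definition _ := isDotProduct.Build R[i] (H * K)%type sum_dot
  sum_dot_gt0.

Fact sum_dot_complete : form_complete sum_dot.
Proof.
have Rege0 (L : hilbertType R) (w : L) : 0 <= complex.Re '[w, w].
  by have := dot_ge0 w; rewrite lecE => /andP[].
have normE w : form_norm sum_dot w =
    Num.sqrt (complex.Re '[w.1, w.1] + complex.Re '[w.2, w.2]).
  by rewrite /form_norm /sum_dot raddfD.
have n1 w : form_norm hdot w.1 <= form_norm sum_dot w.
  by rewrite normE; apply: ler_wsqrtr; rewrite lerDl.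
have n2 w : form_norm hdot w.2 <= form_norm sum_dot w.
  by rewrite normE; apply: ler_wsqrtr; rewrite lerDr.
have n12 w : form_norm sum_dot w <= form_norm hdot w.1 + form_norm hdot w.2.
  rewrite normE /form_norm -[leRHS]ger0_norm ?addr_ge0 ?sqrtr_ge0//.
  rewrite -sqrtr_sqr; apply: ler_wsqrtr.
  rewrite sqrrD !sqr_sqrtr// addrAC lerDl.
  by rewrite mulrn_wge0// mulr_ge0// sqrtr_ge0.
move=> u cu.
have [|l1 hl1] := @hdot_complete R H (fun m => (u m).1).
  move=> e e0; have [N hN] := cu e e0; exists N => m p hm hp.
  exact: le_lt_trans (n1 (u m - u p)) (hN _ _ hm hp).
have [|l2 hl2] := @hdot_complete R K (fun m => (u m).2).
  move=> e e0; have [N hN] := cu e e0; exists N => m p hm hp.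
  exact: le_lt_trans (n2 (u m - u p)) (hN _ _ hm hp).
exists (l1, l2) => e e0; have e20 : 0 < e / 2 by rewrite divr_gt0.
have [N1 h1] := hl1 _ e20; have [N2 h2] := hl2 _ e20.
exists (maxn N1 N2) => m; rewrite geq_max => /andP[m1 m2].
apply: le_lt_trans (n12 _) _; rewrite [ltRHS]splitr.
by apply: ltrD; [exact: h1|exact: h2].
Qed.

HB.instance Definition _ := isHilbert.Build R (H * K)%type sum_dot_complete.
End DirectSum.

Section Operators.
Variables (R : realType) (H : hilbertType R).
Implicit Types T S P : H -> H.

Definition bounded_operator T : Prop :=
  linear T /\ exists M : R, forall u, hnorm (T u) <= M * hnorm u.

Definition adjoint T S : Prop := forall u v, '[T u, v] = '[u, S v].

Definition selfadjoint T : Prop := adjoint T T.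

(* In the order of R[i], 0 <= z says that z is real and nonnegative. *)
Definition positive_operator P : Prop := forall u, 0 <= '[P u, u].

(* P = |T|, the positive square root of T^* T. *)
Definition absolute_value T P : Prop :=
  [/\ bounded_operator P, positive_operator P &
      exists2 S, bounded_operator S /\ adjoint T S & P \o P =1 S \o T].

(* An orthonormal basis is a maximal orthonormal family. *)
Definition orthonormal_basis (I : eqType) (e : I -> H) : Prop :=
  (forall i j, '[e i, e j] = (i == j)%:R) /\
  (forall w, (forall i, '[w, e i] = 0) -> w = 0).

Definition op_trace (I : choiceType) (e : I -> H) P : \bar R :=
  \esum_(i in [set: I]) (complex.Re '[P (e i), e i])%:E.

(* T is trace class when Tr |T| is finite; the trace of a positive operator
   does not depend on the orthonormal basis. *)
Definition trace_class T : Prop :=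
  bounded_operator T /\
  exists2 P, absolute_value T P &
    forall (I : choiceType) (e : I -> H), orthonormal_basis e ->
      (op_trace e P < +oo)%E.

Definition op_commutator S T : H -> H := fun u => S (T u) - T (S u).

End Operators.

HB.mixin Record isStarAlgebra (R : rcfType) A of GRing.Algebra R[i] A := {
  star : A -> A;
  starK : involutive star;
  starD : {morph star : a b / a + b};
  starZ : forall (c : R[i]) (a : A), star (c *: a) = c^* *: star a;
  starM : forall a b : A, star (a * b) = star b * star a
}.

#[short(type="starAlgType")]
HB.structure Definition StarAlgebra (R : rcfType) :=
  {A of GRing.Algebra R[i] A & isStarAlgebra R A}.

Section ScalarStar.
Variable R : rcfType.

Fact regular_starZ (c : R[i]) (a : R[i]^o) :
  conjc (c *: a) = c^* *: (conjc a : R[i]^o).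
Proof. exact: rmorphM. Qed.

Fact regular_starM (a b : R[i]^o) : conjc (a * b) = conjc b * conjc a.
Proof. by rewrite rmorphM mulrC. Qed.

HB.instance Definition _ := isStarAlgebra.Build R R[i]^o
  (@conjcK R) (rmorphD (@conjc R)) regular_starZ regular_starM.
End ScalarStar.

Record star_representation (R : realType) (A : starAlgType R)
    (H : hilbertType R) (psi : A -> H -> H) : Prop := {
  rep_bounded : forall a, bounded_operator (psi a);
  rep1 : psi 1 =1 id;
  repD : forall a b u, psi (a + b) u = psi a u + psi b u;
  repZ : forall (c : R[i]) a u, psi (c *: a) u = c *: psi a u;
  repM : forall a b, psi (a * b) =1 psi a \o psi b;
  rep_star : forall a, adjoint (psi a) (psi (star a))
}.

Record even_1summable_fredholm_module (R : realType) (A : starAlgType R)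
    (H : hilbertType R) (psi : A -> H -> H) (F gamma : H -> H) : Prop := {
  fredholm_rep : star_representation psi;
  grading_bounded : bounded_operator gamma;
  grading_selfadjoint : selfadjoint gamma;
  grading_square : gamma \o gamma =1 id;
  grading_commutes : forall a, gamma \o psi a =1 psi a \o gamma;
  fredholm_bounded : bounded_operator F;
  fredholm_selfadjoint : selfadjoint F;
  fredholm_square : F \o F =1 id;
  fredholm_odd : forall u, F (gamma u) = - gamma (F u);
  fredholm_trace_class : forall a, trace_class (op_commutator F (psi a))
}.

Definition rep_sum (R : realType) (A : starAlgType R) (H K : hilbertType R)
    (phi : A -> H -> H) (psi : A -> K -> K) (a : A) (w : H * K) : H * K :=
  (phi a w.1, psi a w.2).

Definition diag_grading (R : realType) (H : hilbertType R) (w : H * H) : H * H :=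
  (w.1, - w.2).

Definition flip (R : realType) (H : hilbertType R) (w : H * H) : H * H :=
  (w.2, w.1).

Section Relations.
Variables (R : rcfType) (n : nat) (q : R) (A : starAlgType R).
Variable x : 'I_n.+1 -> A.

Fixpoint sphere_s (i : nat) : A :=
  if i is j.+1 then sphere_s j + star (x (inord i)) * x (inord i)
  else x ord0 ^+ 2.

Record sphere_relations : Prop := {
  sphere_x0_selfadjoint : x ord0 = star (x ord0);
  sphere_xx : forall i j : 'I_n.+1, (i < j)%N ->
    x i * x j = q%:C *: (x j * x i);
  sphere_sx : forall i j : 'I_n.+1, i != j ->
    star (x i) * x j = q%:C *: (x j * star (x i));
  sphere_xs : forall i : 'I_n.+1, (0 < i)%N ->
    x i * star (x i) - star (x i) * x i
      = (1 - q ^- 2)%:C *: sphere_s i.-1;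
  sphere_sn : sphere_s n = 1
}.
End Relations.

(* Formal *-polynomials in x_0, ..., x_n; 0 and - t are SScale 0 SOne and
   SScale (-1) t. *)
Inductive star_poly (R : rcfType) (n : nat) : Type :=
| SGen of 'I_n.+1
| SOne
| SAdd of star_poly R n & star_poly R n
| SScale of R[i] & star_poly R n
| SMul of star_poly R n & star_poly R n
| SStar of star_poly R n.

Arguments SGen {R n}.
Arguments SOne {R n}.

HB.instance Definition _ R n := gen_eqMixin (star_poly R n).
HB.instance Definition _ R n := gen_choiceMixin (star_poly R n).

Section QuantumSphere.
Variables (R : rcfType) (n : nat) (q : R).
Local Notation poly := (star_poly R n).

Fixpoint star_eval (A : starAlgType R) (x : 'I_n.+1 -> A) (t : poly) : A :=
  match t with
  | SGen i => x i
  | SOne => 1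
  | SAdd s t => star_eval x s + star_eval x t
  | SScale c t => c *: star_eval x t
  | SMul s t => star_eval x s * star_eval x t
  | SStar t => star (star_eval x t)
  end.

(* The congruence presenting the algebra: s and t are identified when they
   agree in every *-algebra whose chosen generators satisfy the relations. The
   quotient has the universal property of the presentation; see qsphere_gen_rel
   and qsphere_lift below. *)
Definition sphere_equiv (s t : poly) : Prop :=
  forall (A : starAlgType R) (x : 'I_n.+1 -> A), sphere_relations q x ->
    star_eval x s = star_eval x t.

Definition sphere_equivb (s t : poly) : bool := `[< sphere_equiv s t >].

Fact sphere_equivb_equiv : equiv_class_of sphere_equivb.
Proof.
split=> [s|s t|s t u].
- exact/asboolP.
- by apply/asboolP/asboolP => h A x hx; rewrite (h A x hx).
- move=> /asboolP h1 /asboolP h2; apply/asboolP => A x hx.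
  by rewrite (h1 A x hx) (h2 A x hx).
Qed.

Canonical sphere_equiv_rel := EquivRelPack sphere_equivb_equiv.

Definition qsphere : Type := {eq_quot sphere_equiv_rel}.
HB.instance Definition _ := Choice.on qsphere.
HB.instance Definition _ := EqQuotient.on qsphere.

Definition qs_pi (t : poly) : qsphere := \pi t.

Definition qsphere_lift (A : starAlgType R) (x : 'I_n.+1 -> A) (a : qsphere) : A :=
  star_eval x (repr a).

Lemma qsphere_lift_pi (A : starAlgType R) (x : 'I_n.+1 -> A) t :
  sphere_relations q x -> qsphere_lift x (qs_pi t) = star_eval x t.
Proof.
move=> hx; have /eqmodP/asboolP h : repr (qs_pi t) = t %[mod qsphere].
  by rewrite reprK.
exact: h.
Qed.

Lemma qsphere_ext (a b : qsphere) :
  (forall (A : starAlgType R) (x : 'I_n.+1 -> A), sphere_relations q x ->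
    qsphere_lift x a = qsphere_lift x b) -> a = b.
Proof.
move=> h; rewrite -[a]reprK -[b]reprK; apply/eqmodP/asboolP => A x hx.
exact: h.
Qed.

Definition qs_add (a b : qsphere) := qs_pi (SAdd (repr a) (repr b)).
Definition qs_scale c (a : qsphere) := qs_pi (SScale c (repr a)).
Definition qs_mul (a b : qsphere) := qs_pi (SMul (repr a) (repr b)).
Definition qs_star (a : qsphere) := qs_pi (SStar (repr a)).
Definition qs_zero := qs_pi (SScale 0 SOne).
Definition qs_one := qs_pi SOne.
Definition qs_opp (a : qsphere) := qs_scale (-1) a.


Section Morphism.
Variables (A : starAlgType R) (x : 'I_n.+1 -> A).
Hypothesis hx : sphere_relations q x.

Lemma qs_liftD a b :
  qsphere_lift x (qs_add a b) = qsphere_lift x a + qsphere_lift x b.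
Proof. by rewrite qsphere_lift_pi. Qed.
Lemma qs_liftZ c a : qsphere_lift x (qs_scale c a) = c *: qsphere_lift x a.
Proof. by rewrite qsphere_lift_pi. Qed.
Lemma qs_liftM a b :
  qsphere_lift x (qs_mul a b) = qsphere_lift x a * qsphere_lift x b.
Proof. by rewrite qsphere_lift_pi. Qed.
Lemma qs_liftS a : qsphere_lift x (qs_star a) = star (qsphere_lift x a).
Proof. by rewrite qsphere_lift_pi. Qed.
Lemma qs_lift0 : qsphere_lift x qs_zero = 0.
Proof. by rewrite qsphere_lift_pi//= scale0r. Qed.
Lemma qs_lift1 : qsphere_lift x qs_one = 1.
Proof. by rewrite qsphere_lift_pi. Qed.
Lemma qs_liftN a : qsphere_lift x (qs_opp a) = - qsphere_lift x a.
Proof. by rewrite qs_liftZ scaleN1r. Qed.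

End Morphism.

Local Definition qs_liftE := (qs_liftD, qs_liftZ, qs_liftM, qs_liftS, qs_lift0, qs_lift1, qs_liftN).

Fact qs_addA : associative qs_add.
Proof. by move=> a b c; apply: qsphere_ext => A x hx; rewrite !qs_liftE// addrA. Qed.
Fact qs_addC : commutative qs_add.
Proof. by move=> a b; apply: qsphere_ext => A x hx; rewrite !qs_liftE// addrC. Qed.
Fact qs_add0 : left_id qs_zero qs_add.
Proof. by move=> a; apply: qsphere_ext => A x hx; rewrite !qs_liftE// add0r. Qed.
Fact qs_addN : left_inverse qs_zero qs_opp qs_add.
Proof. by move=> a; apply: qsphere_ext => A x hx; rewrite !qs_liftE// addNr. Qed.

HB.instance Definition _ :=
  GRing.isZmodule.Build qsphere qs_addA qs_addC qs_add0 qs_addN.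

Fact qs_mulA : associative qs_mul.
Proof. by move=> a b c; apply: qsphere_ext => A x hx; rewrite !qs_liftE// mulrA. Qed.
Fact qs_mul1l : left_id qs_one qs_mul.
Proof. by move=> a; apply: qsphere_ext => A x hx; rewrite !qs_liftE// mul1r. Qed.
Fact qs_mul1r : right_id qs_one qs_mul.
Proof. by move=> a; apply: qsphere_ext => A x hx; rewrite !qs_liftE// mulr1. Qed.
Fact qs_mulDl : left_distributive qs_mul qs_add.
Proof. by move=> a b c; apply: qsphere_ext => A x hx; rewrite !qs_liftE// mulrDl. Qed.
Fact qs_mulDr : right_distributive qs_mul qs_add.
Proof. by move=> a b c; apply: qsphere_ext => A x hx; rewrite !qs_liftE// mulrDr. Qed.

HB.instance Definition _ :=
  GRing.Zmodule_isPzRing.Build qsphere qs_mulA qs_mul1l qs_mul1r qs_mulDl qs_mulDr.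


Fact qs_1neq0 : qs_one != qs_zero.
Proof.
pose x (i : 'I_n.+1) : R[i]^o := (i == ord_max)%:R.
have starx i : star (x i) = x i by rewrite /x /star /= conjc_nat.
have s0 m : (m < n)%N -> sphere_s x m = 0.
  elim: m => [|m IH] hm /=.
    by rewrite /x -val_eqE /= ltn_eqF// expr2 mul0r.
  rewrite IH 1?ltnW// /x -val_eqE /= inordK ?ltnS 1?ltnW//.
  by rewrite (ltn_eqF hm) mulr0 addr0.
have hx : sphere_relations q x.
  split.
  - by rewrite starx.
  - by move=> i j ij; rewrite mulrC /x -(val_eqE i) /= ltn_eqF ?mulr0 ?scaler0//
      (leq_trans ij)// -ltnS.
  - move=> i j; rewrite starx /x => ij; have [i1|] := eqVneq i ord_max.
      have := ij; rewrite i1 eq_sym => /negbTE ->.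
      by rewrite mulr0 mul0r scaler0.
    by rewrite mulr0 mul0r scaler0.
  - move=> i i0; rewrite mulrC subrr s0 ?scaler0//.
    by rewrite prednK// -ltnS.
  - case: (posnP n) => [n0|n0].
      have -> : sphere_s x n = x ord0 ^+ 2 by case: (n) n0 x {starx s0}.
      by rewrite /x -val_eqE /= n0 eqxx expr1n.
    rewrite -[X in sphere_s x X](prednK n0) /= s0 ?prednK// starx.
    by rewrite /x -val_eqE /= inordK// eqxx mulr1 add0r.
apply/eqP => /(congr1 (qsphere_lift x)).
by rewrite qs_lift1// qs_lift0//; apply/eqP/oner_neq0.
Qed.

HB.instance Definition _ := GRing.PzSemiRing_isNonZero.Build qsphere qs_1neq0.

Fact qs_scaleA c d a : qs_scale c (qs_scale d a) = qs_scale (c * d) a.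
Proof. by apply: qsphere_ext => A x hx; rewrite !qs_liftE// scalerA. Qed.
Fact qs_scale1 : left_id 1 qs_scale.
Proof. by move=> a; apply: qsphere_ext => A x hx; rewrite !qs_liftE// scale1r. Qed.
Fact qs_scaleDr : right_distributive qs_scale qs_add.
Proof. by move=> c a b; apply: qsphere_ext => A x hx; rewrite !qs_liftE// scalerDr. Qed.
Fact qs_scaleDl a : {morph qs_scale^~ a : c d / c + d >-> qs_add c d}.
Proof. by move=> c d; apply: qsphere_ext => A x hx; rewrite !qs_liftE// scalerDl. Qed.

HB.instance Definition _ := GRing.Zmodule_isLmodule.Build R[i] qsphere
  qs_scaleA qs_scale1 qs_scaleDr qs_scaleDl.

Fact qs_scaleAl c a b : qs_scale c (qs_mul a b) = qs_mul (qs_scale c a) b.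
Proof. by apply: qsphere_ext => A x hx; rewrite !qs_liftE// scalerAl. Qed.
HB.instance Definition _ :=
  GRing.Lmodule_isLalgebra.Build R[i] qsphere qs_scaleAl.

Fact qs_scaleAr c a b : qs_scale c (qs_mul a b) = qs_mul a (qs_scale c b).
Proof. by apply: qsphere_ext => A x hx; rewrite !qs_liftE// scalerAr. Qed.
HB.instance Definition _ :=
  GRing.Lalgebra_isAlgebra.Build R[i] qsphere qs_scaleAr.

Fact qs_starK : involutive qs_star.
Proof. by move=> a; apply: qsphere_ext => A x hx; rewrite !qs_liftE// starK. Qed.
Fact qs_starD : {morph qs_star : a b / qs_add a b}.
Proof. by move=> a b; apply: qsphere_ext => A x hx; rewrite !qs_liftE// starD. Qed.
Fact qs_starZ c a : qs_star (qs_scale c a) = qs_scale c^* (qs_star a).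
Proof. by apply: qsphere_ext => A x hx; rewrite !qs_liftE// starZ. Qed.
Fact qs_starM a b : qs_star (qs_mul a b) = qs_mul (qs_star b) (qs_star a).
Proof. by apply: qsphere_ext => A x hx; rewrite !qs_liftE// starM. Qed.

HB.instance Definition _ := isStarAlgebra.Build R qsphere
  qs_starK qs_starD qs_starZ qs_starM.

Definition qs_gen (i : 'I_n.+1) : qsphere := qs_pi (SGen i).


Lemma qsphere_lift_gen (A : starAlgType R) (x : 'I_n.+1 -> A) i :
  sphere_relations q x -> qsphere_lift x (qs_gen i) = x i.
Proof. by move=> hx; rewrite qsphere_lift_pi. Qed.

Lemma qsphere_lift_morphism (A : starAlgType R) (x : 'I_n.+1 -> A) :
  sphere_relations q x ->
  [/\ {morph qsphere_lift x : a b / a + b}, {morph qsphere_lift x : a b / a * b},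
      qsphere_lift x 1 = 1,
      forall (c : R[i]) a, qsphere_lift x (c *: a) = c *: qsphere_lift x a &
      forall a, qsphere_lift x (star a) = star (qsphere_lift x a)].
Proof.
move=> hx; split.
- by move=> a b; exact: qs_liftD.
- by move=> a b; exact: qs_liftM.
- exact: qs_lift1.
- by move=> c a; exact: qs_liftZ.
- by move=> a; exact: qs_liftS.
Qed.

Lemma qsphere_gen_rel : sphere_relations q qs_gen.
Proof.
have lS (A : starAlgType R) (x : 'I_n.+1 -> A) m : sphere_relations q x ->
    qsphere_lift x (sphere_s qs_gen m) = sphere_s x m.
  move=> hx; have [lD lM _ _ ls] := qsphere_lift_morphism hx.
  by elim: m => [|m IH] /=; rewrite ?lD ?IH ?lM ?ls ?qsphere_lift_gen.
split=> [|i j ij|i j ij|i i0|]; apply: qsphere_ext => A x hx;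
  have [lD lM l1 lZ ls] := qsphere_lift_morphism hx.
- by rewrite ls !qsphere_lift_gen//; case: hx.
- by rewrite lZ !lM !qsphere_lift_gen//; case: hx => _ h _ _ _; exact: h.
- by rewrite lZ !lM ls !qsphere_lift_gen//; case: hx => _ _ h _ _; exact: h.
- rewrite -scaleN1r lZ lD !lZ !lM !ls lS// !qsphere_lift_gen// scaleN1r.
  by case: hx => _ _ _ h _; exact: h.
- by rewrite lS// l1; case: hx.
Qed.

Lemma qsphere_ind (P : qsphere -> Prop) :
  (forall i, P (qs_gen i)) -> P 1 ->
  (forall a b, P a -> P b -> P (a + b)) ->
  (forall (c : R[i]) a, P a -> P (c *: a)) ->
  (forall a b, P a -> P b -> P (a * b)) ->
  (forall a, P a -> P (star a)) -> forall a, P a.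
Proof.
move=> Pg P1 PD PZ PM PS a; rewrite -[a]reprK; move: (repr a) => {a}.
pose pi t : qsphere := qs_pi t.
have piE t s : (forall (A : starAlgType R) (x : 'I_n.+1 -> A),
    sphere_relations q x -> qsphere_lift x (pi t) = qsphere_lift x s) -> pi t = s.
  exact: qsphere_ext.
suff h t : P (pi t) by exact: h.
elim: t => [i||s IHs t IHt|c t IHt|s IHs t IHt|t IHt].
- exact: Pg.
- exact: P1.
- rewrite (piE _ (pi s + pi t)); first exact: PD.
  by move=> A x hx; have [-> _ _ _ _] := qsphere_lift_morphism hx;
    rewrite !qsphere_lift_pi.
- rewrite (piE _ (c *: pi t)); first exact: PZ.
  by move=> A x hx; have [_ _ _ -> _] := qsphere_lift_morphism hx;
    rewrite !qsphere_lift_pi.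
- rewrite (piE _ (pi s * pi t)); first exact: PM.
  by move=> A x hx; have [_ -> _ _ _] := qsphere_lift_morphism hx;
    rewrite !qsphere_lift_pi.
- rewrite (piE _ (star (pi t))); first exact: PS.
  by move=> A x hx; have [_ _ _ _ ->] := qsphere_lift_morphism hx;
    rewrite !qsphere_lift_pi.
Qed.

End QuantumSphere.

Definition multi_index (n : nat) := {ffun 'I_n -> nat}.

(* |k_0, ..., k_i - 1, ..., k_(n-1)>.  When k_i = 0 the subtraction truncates,
   but then the coefficient in front of this vector below vanishes. *)
Definition lower (n : nat) (i : 'I_n) (k : multi_index n) : multi_index n :=
  [ffun j => (k j - (j == i))%N].

(* The *-representation with sign sg = 1 or sg = -1.  The index i : 'I_n stands
   for the generator x_(i+1), i.e. x_(lift ord0 i). *)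
Record sphere_representation (R : realType) (n : nat) (q sg : R)
    (H : hilbertType R) (e : multi_index n -> H)
    (psi : qsphere n q -> H -> H) : Prop := {
  sphere_rep_star : star_representation psi;
  sphere_rep_x0 : forall k : multi_index n,
    psi (qs_gen q ord0) (e k) = (sg * q ^- (\sum_(j < n) k j))%:C *: e k;
  sphere_rep_xi : forall (i : 'I_n) (k : multi_index n),
    psi (qs_gen q (lift ord0 i)) (e k) =
      (Num.sqrt (1 - q ^- (2 * k i)) * q ^- (\sum_(j < n | (i < j)%N) k j))%:C
        *: e (lower i k)
}.

(* Main.v *)
(* Write D a = psi_plus a - psi_minus a and X = psi_plus x_0.  The two
   representations agree on x_1, ..., x_n and differ by a sign on x_0, and x_0
   commutes with every x_i and x_i^* up to a scalar.  Since
   D (a b) = psi_plus a D b + D a psi_minus b, it follows by induction over A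
   that |D a u| <= M |X u| for all u, with M depending on a.  Hence
   sum_k |D a e_k| <= M sum_k |q|^-(k_0 + ... + k_(n-1)) < +oo.

   Such a summable operator T is trace class: with P = |T| the trace of P in
   the basis e is at most sum_k |P e_k| = sum_k |T e_k|, and with S = P^(1/2)
   the bound passes to any other basis by the inequalities of Parseval and
   Bessel.  Square roots of positive operators are obtained as norm limits of
   the iteration Y |-> (B + Y^2) / 2. *)
Require Import Defs.
From mathcomp Require Import all_boot all_order all_algebra.
From mathcomp Require Import complex boolp classical_sets fsbigop.
From mathcomp Require Import reals ereal esum ring lra.
Import Order.TTheory GRing.Theory Num.Theory.
Set Implicit Arguments.
Unset Strict Implicit.
Unset Printing Implicit Defensive.
Local Open Scope ring_scope.
Local Open Scope complex_scope.

(** * Inner products, norms and the Cauchy-Schwarz inequality *)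

Section InnerProduct.
Variables (R : rcfType) (H : hilbertType R).
Implicit Types (u v w : H) (a b : R) (c : R[i]).

Lemma sqr_normcE c : (Normc.normc c ^+ 2)%:C = c * conjc c.
Proof. by rewrite -sqr_normc rmorphXn. Qed.

Lemma normc_ge0 c : 0 <= Normc.normc c.
Proof. by case: c => a b; exact: sqrtr_ge0. Qed.

Lemma Re_le_normc c : complex.Re c <= Normc.normc c.
Proof.
have := normc_ge_Re c; rewrite lecR; apply: le_trans; exact: ler_norm.
Qed.

Lemma normc_realr a : Normc.normc a%:C = `|a|.
Proof. by rewrite /= expr0n addr0 sqrtr_sqr. Qed.

Lemma hdotC u v : '[u, v] = conjc '[v, u].
Proof. by rewrite [LHS]hermC expr0 mul1r. Qed.

Lemma Re_hdotC u v : complex.Re '[u, v] = complex.Re '[v, u].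
Proof. by rewrite hdotC; case: ('[v, u]). Qed.

Lemma normc_hdotC u v : Normc.normc '[u, v] = Normc.normc '[v, u].
Proof. by rewrite hdotC; case: ('[v, u]) => a b /=; rewrite sqrrN. Qed.

Lemma hdotDl u v w : '[u + v, w] = '[u, w] + '[v, w].
Proof. exact: linearDl. Qed.
Lemma hdotDr u v w : '[w, u + v] = '[w, u] + '[w, v].
Proof. exact: linearDr. Qed.
Lemma hdotBl u v w : '[u - v, w] = '[u, w] - '[v, w].
Proof. exact: linearBl. Qed.
Lemma hdotBr u v w : '[w, u - v] = '[w, u] - '[w, v].
Proof. exact: linearBr. Qed.
Lemma hdotZl c u v : '[c *: u, v] = c * '[u, v].
Proof. exact: linearZl_LR. Qed.
Lemma hdotZr c u v : '[u, c *: v] = conjc c * '[u, v].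
Proof. exact: linearZr_LR. Qed.
Lemma hdotNl u v : '[- u, v] = - '[u, v].
Proof. exact: linearNl. Qed.
Lemma hdotNr u v : '[u, - v] = - '[u, v].
Proof. exact: linearNr. Qed.
Lemma hdot0l u : '[0, u] = 0.
Proof. exact: linear0l. Qed.
Lemma hdot0r u : '[u, 0] = 0.
Proof. exact: linear0r. Qed.

Lemma hdot_suml (I : Type) (r : seq I) (F : I -> H) v :
  '[\sum_(i <- r) F i, v] = \sum_(i <- r) '[F i, v].
Proof.
by apply: (big_morph (fun u => '[u, v])) => [u w|]; rewrite ?hdotDl ?hdot0l.
Qed.

Lemma hdot_sumr (I : Type) (r : seq I) (F : I -> H) v :
  '[v, \sum_(i <- r) F i] = \sum_(i <- r) '[v, F i].
Proof.
by apply: (big_morph (fun u => '[v, u])) => [u w|]; rewrite ?hdotDr ?hdot0r.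
Qed.

Lemma hdot_ge0 u : 0 <= '[u, u].
Proof.
have [->|u0] := eqVneq u 0; first by rewrite hdot0l.
exact: ltW (neq0_dnorm_gt0 u u0).
Qed.

Lemma hnorm_ge0 u : 0 <= hnorm u.
Proof. exact: sqrtr_ge0. Qed.

Lemma sqr_hnorm u : hnorm u ^+ 2 = complex.Re '[u, u].
Proof.
rewrite /hnorm /form_norm sqr_sqrtr//.
by have := hdot_ge0 u; rewrite lecE => /andP[].
Qed.

Lemma hdotE u : '[u, u] = (hnorm u ^+ 2)%:C.
Proof. by rewrite sqr_hnorm RRe_real// ger0_real// hdot_ge0. Qed.

Lemma hnorm0 : hnorm (0 : H) = 0.
Proof. by apply/eqP; rewrite -sqrf_eq0 sqr_hnorm hdot0l. Qed.

Lemma hnorm_eq0 u : hnorm u = 0 -> u = 0.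
Proof.
move=> u0; apply/eqP/negPn/negP => /(@neq0_dnorm_gt0 _ _ _ (@hdot R H)).
by rewrite hdotE u0 expr0n ltxx.
Qed.

Lemma hnormZ c u : hnorm (c *: u) = Normc.normc c * hnorm u.
Proof.
apply/eqP; rewrite -(@eqrXn2 _ 2)// ?mulr_ge0 ?hnorm_ge0 ?normc_ge0//.
apply/eqP/complexI; rewrite -hdotE exprMn rmorphM /= -hdotE sqr_normcE.
by rewrite hdotZl hdotZr mulrA.
Qed.

Lemma hnormZr a u : hnorm (a%:C *: u) = `|a| * hnorm u.
Proof. by rewrite hnormZ normc_realr. Qed.

Lemma hnorm_opp u : hnorm (- u) = hnorm u.
Proof. by rewrite -scaleN1r hnormZ normcN Normc.normc1 mul1r. Qed.

Lemma hnorm_sub u v : hnorm (u - v) = hnorm (v - u).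
Proof. by rewrite -opprB hnorm_opp. Qed.

Lemma sqr_hnormD u v :
  hnorm (u + v) ^+ 2 = hnorm u ^+ 2 + complex.Re '[u, v] *+ 2 + hnorm v ^+ 2.
Proof.
rewrite !sqr_hnorm hdotDl !hdotDr !raddfD /= (Re_hdotC v u) mulr2n.
by rewrite !addrA.
Qed.

Lemma sqr_hnormB u v :
  hnorm (u - v) ^+ 2 = hnorm u ^+ 2 - complex.Re '[u, v] *+ 2 + hnorm v ^+ 2.
Proof. by rewrite sqr_hnormD hnorm_opp hdotNr raddfN mulNrn. Qed.

Lemma hdot_cauchy_schwarz u v :
  Normc.normc '[u, v] <= hnorm u * hnorm v.
Proof.
have [->|v0] := eqVneq v 0.
  by rewrite hdot0r Normc.normc0 mulr_ge0 ?hnorm_ge0.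
have vp : 0 < hnorm v.
  rewrite lt_def hnorm_ge0 andbT; apply: contraNneq v0 => /hnorm_eq0 ->.
  exact: eqxx.
set z := '[u, v]; rewrite -(@ler_pXn2r _ 2) ?nnegrE ?mulr_ge0 ?hnorm_ge0 ?normc_ge0//.
(* The vector |v|^2 u - <u, v> v is |v|^2 times the component of u orthogonal to v; its squared norm
   expands to |v|^2 (|u|^2 |v|^2 - |<u, v>|^2). *)
have := sqr_ge0 (hnorm ((hnorm v ^+ 2)%:C *: u - z *: v)).
rewrite sqr_hnormB !hnormZ normc_realr ger0_norm ?sqr_ge0//.
rewrite hdotZl hdotZr -/z (mulrC (conjc z)) -sqr_normcE -rmorphM /= => h.
have : 0 <= hnorm v ^+ 2 * ((hnorm u * hnorm v) ^+ 2 - Normc.normc z ^+ 2).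
  by apply: le_trans h _; rewrite le_eqVlt; apply/orP; left; apply/eqP; ring.
by rewrite pmulr_rge0 ?exprn_gt0// subr_ge0.
Qed.

Lemma Re_hdot_le u v : complex.Re '[u, v] <= hnorm u * hnorm v.
Proof. exact: le_trans (Re_le_normc _) (hdot_cauchy_schwarz u v). Qed.

Lemma hnorm_triangle u v : hnorm (u + v) <= hnorm u + hnorm v.
Proof.
rewrite -(@ler_pXn2r _ 2) ?nnegrE ?addr_ge0 ?hnorm_ge0// sqr_hnormD.
rewrite sqrrD lerD2r lerD2l lerMn2r /=; exact: Re_hdot_le.
Qed.

Lemma hnorm_triangleB u v w : hnorm (u - w) <= hnorm (u - v) + hnorm (v - w).
Proof. by rewrite -{1}(subrKA v); exact: hnorm_triangle. Qed.

Lemma hdot_eqr u v : (forall w, '[w, u] = '[w, v]) -> u = v.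
Proof.
move=> h; apply/eqP; rewrite -subr_eq0; apply/eqP/hnorm_eq0/eqP.
by rewrite -sqrf_eq0 sqr_hnorm hdotBr h subrr.
Qed.

End InnerProduct.

(** * Linear maps, bounded operators and adjoints *)

Section LinearOperators.
Variables (R : realType) (H : hilbertType R).
Implicit Types (T S : H -> H) (u v : H).

Lemma operD T u v : linear T -> T (u + v) = T u + T v.
Proof. by move=> lT; rewrite -[u in LHS]scale1r lT scale1r. Qed.

Lemma oper0 T : linear T -> T 0 = 0.
Proof. by move=> lT; apply: (addrI (T 0)); rewrite -operD// !addr0. Qed.

Lemma operZ T c u : linear T -> T (c *: u) = c *: T u.
Proof. by move=> lT; rewrite -[c *: u]addr0 lT oper0// addr0. Qed.

Lemma operN T u : linear T -> T (- u) = - T u.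
Proof. by move=> lT; rewrite -scaleN1r (operZ _ _ lT) scaleN1r. Qed.

Lemma operB T u v : linear T -> T (u - v) = T u - T v.
Proof. by move=> lT; rewrite (operD _ _ lT) (operN _ lT). Qed.

Lemma bounded_operator_gt0 T : bounded_operator T ->
  exists2 M : R, 0 < M & forall u, hnorm (T u) <= M * hnorm u.
Proof.
move=> [_ [M hM]]; exists (`|M| + 1) => [|u]; first by rewrite ltr_wpDl.
apply: le_trans (hM u) _; rewrite ler_wpM2r ?hnorm_ge0//.
by rewrite ler_wpDr// ler_norm.
Qed.

Lemma adjoint_sym T S : adjoint T S -> adjoint S T.
Proof. by move=> TS u v; rewrite hdotC -TS -hdotC. Qed.

(** Pairing with any w and moving the map onto w leaves the argument alone in the inner product. In
    particular, linearity of a self-adjoint map comes for free. *)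
Lemma adjoint_linear T S : adjoint T S -> linear T.
Proof.
move=> TS c u v; apply: hdot_eqr => w; have ST := adjoint_sym TS.
by rewrite -ST hdotDr hdotZr hdotDr hdotZr -!ST.
Qed.

End LinearOperators.

(** * An iteration solving 2 L = B + L^2 for a self-adjoint contraction B *)

Section SquareRootIteration.
Variables (R : realType) (H : hilbertType R) (B : H -> H).
Hypotheses (Bsa : selfadjoint B) (Bcontr : forall u, hnorm (B u) <= hnorm u).
Implicit Types (u v : H) (m p : nat).

(* The iteration x |-> (b + x^2) / 2 started at 0, which increases to
   1 - (1 - b)^(1/2). *)
Fixpoint sqrt_iter m u : H :=
  if m is p.+1 then (2^-1 : R)%:C *: (B u + sqrt_iter p (sqrt_iter p u)) else 0.

(** The scalar case b = 1, increasing to 1. Its values and increments majorise those of [sqrt_iter]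
    in operator norm. *)
Fixpoint sqrt_iter1 m : R :=
  if m is p.+1 then 2^-1 * (1 + sqrt_iter1 p ^+ 2) else 0.

Local Notation Y := sqrt_iter.
Local Notation y := sqrt_iter1.
Let d m : R := 2 / m.+2%:R.

Lemma sqrt_iter1_ge0 m : 0 <= y m.
Proof. by case: m => //= m; rewrite mulr_ge0 ?invr_ge0// addr_ge0// sqr_ge0. Qed.

Lemma sqrt_iter1_le1 m : y m <= 1.
Proof.
elim: m => [|m IH] //=; have := sqrt_iter1_ge0 m; move: (y m) IH => z; nra.
Qed.

Lemma sqrt_iter1_nondecreasing m : y m <= y m.+1.
Proof. by rewrite -subr_ge0 /=; have := sqr_ge0 (1 - y m); lra. Qed.

(** The gap g = 1 - y_m evolves by g |-> g - g^2/2, which is increasing on [0, 1]. It remains to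
    check s - s^2/2 <= 2/(k + 1) for s = 2/k and k = m + 2. *)
Lemma sqrt_iter1_rate m : 1 - y m <= d m.
Proof.
rewrite /d; elim: m => [|m IH]; first by rewrite /= subr0 divff.
have := sqrt_iter1_ge0 m; have := sqrt_iter1_le1 m; move: IH => /=.
set z := y m; set s := 2 / _ => h z1 z0.
rewrite ler_pdivlMr ?ltr0n//.
have -> : m.+3%:R = m.+2%:R + 1 :> R by rewrite natr1.
have k2 : 2 <= m.+2%:R :> R by rewrite ler_nat.
have : s * m.+2%:R = 2 by rewrite divfK// pnatr_eq0.
move: (m.+2%:R) k2 => k k2 sk.
have s1 : s <= 1 by nra.
have s0 : 0 <= s by nra.
have : 1 - 2^-1 * (1 + z ^+ 2) <= s - s ^+ 2 / 2.
  have a1 : 0 <= s - (1 - z) by lra.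
  have a2 : 0 <= 1 + z - s by lra.
  by have := mulr_ge0 a1 a2; lra.
have k1 : 0 <= k + 1 by lra.
move=> /(ler_wpM2r k1) /le_trans; apply.
have -> : (s - s ^+ 2 / 2) * (k + 1) = s * k + s - s / 2 * (s * k) - s ^+ 2 / 2.
  by ring.
by rewrite sk; have := sqr_ge0 s; lra.
Qed.

Lemma sqrt_iter_selfadjoint m : selfadjoint (Y m).
Proof.
elim: m => [|m IH] u v /=; first by rewrite hdot0l hdot0r.
by rewrite hdotZl hdotZr conjc_real hdotDl hdotDr Bsa !IH.
Qed.

Lemma sqrt_iter_norm m u : hnorm (Y m u) <= y m * hnorm u.
Proof.
elim: m u => [|m IH] u /=; first by rewrite hnorm0 mul0r.
rewrite hnormZr ger0_norm ?invr_ge0// -mulrA ler_wpM2l ?invr_ge0//.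
apply: le_trans (hnorm_triangle _ _) _; rewrite mulrDl mul1r lerD//.
apply: le_trans (IH _) _; rewrite expr2 -mulrA ler_wpM2l// sqrt_iter1_ge0//.
Qed.

Lemma sqrt_iter_contraction m u : hnorm (Y m u) <= hnorm u.
Proof.
apply: le_trans (sqrt_iter_norm m u) _.
by rewrite ler_piMl ?hnorm_ge0// sqrt_iter1_le1.
Qed.

Let Ylin m : linear (Y m) := adjoint_linear (@sqrt_iter_selfadjoint m).

(* Y_(m+1)^2 - Y_m^2 = Y_(m+1) (Y_(m+1) - Y_m) + (Y_(m+1) - Y_m) Y_m, so no
   commutation between the iterates is needed. *)
Lemma sqrt_iter_step m u :
  hnorm (Y m.+1 u - Y m u) <= (y m.+1 - y m) * hnorm u.
Proof.
elim: m u => [|m IH] u.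
  rewrite [Y 0 u]/= !subr0; exact: sqrt_iter_norm.
set z := Y m.+1 in IH *; set x := Y m in IH *.
have lz : linear z := @Ylin m.+1.
have -> : Y m.+2 u - z u =
    (2^-1 : R)%:C *: (z (z u - x u) + (z (x u) - x (x u))).
  rewrite (operB _ _ lz).
  rewrite [Y m.+2 u]/= -/z {1}/z [Y m.+1 u]/= -/x -scalerBr; congr (_ *: _).
  by rewrite opprD addrACA subrr add0r subrKA.
rewrite hnormZr ger0_norm ?invr_ge0//.
have -> : y m.+2 - y m.+1 = 2^-1 * (y m.+1 * (y m.+1 - y m) + (y m.+1 - y m) * y m).
  have e2 : y m.+2 = 2^-1 * (1 + y m.+1 ^+ 2) by [].
  have : y m.+1 = 2^-1 * (1 + y m ^+ 2) by [].
  by rewrite e2; move: (y m.+1) (y m) => a b; lra.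
rewrite -mulrA ler_wpM2l ?invr_ge0// mulrDl.
apply: le_trans (hnorm_triangle _ _) _; apply: lerD.
  apply: le_trans (sqrt_iter_norm _ _) _.
  by rewrite -mulrA ler_wpM2l ?sqrt_iter1_ge0.
apply: le_trans (IH _) _; rewrite -mulrA ler_wpM2l ?sqrt_iter_norm//.
by rewrite subr_ge0 sqrt_iter1_nondecreasing.
Qed.

Lemma sqrt_iter_dist m p u : hnorm (Y (m + p) u - Y m u) <= d m * hnorm u.
Proof.
suff h : hnorm (Y (m + p) u - Y m u) <= (y (m + p) - y m) * hnorm u.
  apply: le_trans h _; rewrite ler_wpM2r ?hnorm_ge0//.
  by apply: le_trans (sqrt_iter1_rate m); rewrite lerD2r sqrt_iter1_le1.
elim: p => [|p IH]; first by rewrite addn0 !subrr hnorm0 mul0r.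
rewrite addnS; apply: le_trans (hnorm_triangleB _ (Y (m + p) u) _) _.
apply: le_trans (lerD (sqrt_iter_step _ _) IH) _.
by rewrite -mulrDl addrA subrK.
Qed.

(** The Archimedean property, in the form used to pass to the limit in estimates of order [d m]. *)
Lemma sqrt_rate_small (a K : R) : (forall m, a <= K * d m) -> a <= 0.
Proof.
move=> h; rewrite leNgt; apply/negP => a0.
have K0 : 0 < K.
  by have := lt_le_trans a0 (h 0); rewrite pmulr_lgt0// divr_gt0.
have [N hN] : exists N : nat, K * 2 / a < N%:R.
  exists (Num.truncn (K * 2 / a)).+1; exact: truncnS_gt.
have := h N; rewrite /d mulrA ler_pdivlMr ?ltr0n// leNgt => /negP; apply.
rewrite ltr_pdivrMr// (mulrC N%:R) in hN; apply: lt_trans hN _.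
by rewrite ltr_pM2l// ltr_nat.
Qed.

Lemma sqrt_iter_cvg : exists L : H -> H, forall m u, hnorm (Y m u - L u) <= d m * hnorm u.
Proof.
have h u : exists l, forall m, hnorm (Y m u - l) <= d m * hnorm u.
  have [|l hl] := @hdot_complete R H (Y^~ u).
    move=> e e0; have [N hN] : exists N : nat, d N * hnorm u * 2 < e.
      apply: contrapT => /forallNP h; move: e0; apply/negP; rewrite -leNgt.
      apply: (@sqrt_rate_small _ (hnorm u * 2)) => m.
      by have /negP := h m; rewrite -leNgt; lra.
    exists N => m p /subnKC <- /subnKC <-.
    apply: le_lt_trans hN; apply: le_trans (hnorm_triangleB _ (Y N u) _) _.
    by rewrite mulr_natr mulr2n lerD ?sqrt_iter_dist// hnorm_sub sqrt_iter_dist.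
  (* The bound on the distance from the iterate m to the iterate m + p is uniform in p, hence
     survives the limit in p. *)
  exists l => m; apply/ler_addgt0Pl => e e0; have [N hN] := hl e e0.
  apply: le_trans (hnorm_triangleB _ (Y (m + N) u) _) _; rewrite addrC lerD//.
    by apply/ltW/hN; rewrite leq_addl.
  by rewrite hnorm_sub sqrt_iter_dist.
have [L hL] := choice h; by exists L.
Qed.

(** The identity is the limit of the recursion 2 Y_(m+1) = B + Y_m^2; it amounts to (1 - L)^2 = 1 -
    B. *)
Lemma contraction_sqrt_limit : exists L : H -> H,
  [/\ selfadjoint L, forall u, hnorm (L u) <= hnorm u &
      forall u, (2 : R)%:C *: L u = B u + L (L u)].
Proof.
have [L hL] := sqrt_iter_cvg; exists L.
have Lsa : selfadjoint L.
  move=> u v; apply/eqP; rewrite -subr_eq0; apply/eqP/Normc.eq0_normc/eqP.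
  rewrite eq_le normc_ge0 andbT.
  apply: (@sqrt_rate_small _ (2 * (hnorm u * hnorm v))) => m.
  have -> : '[L u, v] - '[u, L v] = '[u, Y m v - L v] - '[Y m u - L u, v].
    by rewrite hdotBl hdotBr sqrt_iter_selfadjoint opprB [RHS]addrC subrKA.
  apply: le_trans (le_normcD _ _) _; rewrite normcN.
  have h1 := le_trans (hdot_cauchy_schwarz u (Y m v - L v))
    (ler_wpM2l (hnorm_ge0 u) (hL m v)).
  have h2 := le_trans (hdot_cauchy_schwarz (Y m u - L u) v)
    (ler_wpM2r (hnorm_ge0 v) (hL m u)).
  by apply: le_trans (lerD h1 h2) _; lra.
have Lnorm u : hnorm (L u) <= hnorm u.
  rewrite -subr_le0; apply: (@sqrt_rate_small _ (hnorm u)) => m.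
  rewrite lerBlDl mulrC -[in leLHS](subrK (Y m u) (L u)).
  apply: le_trans (hnorm_triangle _ _) _; rewrite addrC lerD//.
    exact: sqrt_iter_contraction.
  by rewrite hnorm_sub.
split=> // u; apply/eqP; rewrite -subr_eq0; apply/eqP/hnorm_eq0/eqP.
rewrite eq_le hnorm_ge0 andbT.
have Llin := adjoint_linear Lsa.
(* Subtracting the recursion at [m] leaves 2 (L - Y_(m+1)), Y_m (Y_m - L) and (Y_m - L) L, which
   contribute 2, 1 and 1 times [d m]. *)
apply: (@sqrt_rate_small _ (4 * hnorm u)) => m.
have -> : (2 : R)%:C *: L u - (B u + L (L u)) =
   (2 : R)%:C *: (L u - Y m.+1 u) +
   (Y m (Y m u - L u) + (Y m (L u) - L (L u))).
  rewrite (operB _ _ (Ylin m)).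
  rewrite subrKA scalerBr [Y m.+1 u]/= scalerA -rmorphM divff// scale1r.
  by rewrite !opprD !addrA subrK.
apply: le_trans (hnorm_triangle _ _) _.
apply: le_trans (lerD (lexx _) (hnorm_triangle _ _)) _.
rewrite hnormZr ger0_norm//.
have h1 : hnorm (L u - Y m.+1 u) <= d m * hnorm u.
  rewrite hnorm_sub; apply: le_trans (hL _ _) _.
  rewrite ler_wpM2r ?hnorm_ge0// /d ler_wpM2l// lef_pV2 ?posrE ?ltr0n//.
  by rewrite ler_nat.
have h2 : hnorm (Y m (Y m u - L u)) <= d m * hnorm u.
  exact: le_trans (sqrt_iter_contraction _ _) (hL _ _).
have h3 : hnorm (Y m (L u) - L (L u)) <= d m * hnorm u.
  apply: le_trans (hL _ _) _; rewrite ler_wpM2l// /d divr_ge0//.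
lra.
Qed.

End SquareRootIteration.

(** * Square roots of positive bounded operators *)

Section SquareRoot.
Variables (R : realType) (H : hilbertType R).

Lemma hdot_selfadjointE (T : H -> H) u :
  selfadjoint T -> '[T u, u] = (complex.Re '[T u, u])%:C.
Proof.
move=> sT; have := hdotC (T u) u; rewrite -sT.
case: ('[T u, u]) => a b [] /eqP; rewrite -subr_eq0 opprK -mulr2n mulrn_eq0 /=.
by move=> /eqP ->.
Qed.

(* The square root of A is 1 - lim Y_m for the iteration with B = 1 - A. *)
Lemma contraction_sqrt (A : H -> H) :
  selfadjoint A -> positive_operator A -> (forall u, hnorm (A u) <= hnorm u) ->
  exists S : H -> H, [/\ bounded_operator S, positive_operator S,
    selfadjoint S & S \o S =1 A].
Proof.
move=> sA pA cA; pose B u := u - A u; have lA := adjoint_linear sA.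
have ReA u : 0 <= complex.Re '[A u, u].
  by have := pA u; rewrite hdot_selfadjointE// ler0c.
have sB : selfadjoint B by move=> u v; rewrite /B hdotBl hdotBr sA.
(* Positivity of A at u - A u, together with <A^2 u, A u> <= |A u|^2, gives |A u|^2 <= <A u, u>.
   Hence |u - A u|^2 <= |u|^2 - <A u, u> <= |u|^2. *)
have cB u : hnorm (B u) <= hnorm u.
  have h := ReA (u - A u); have := cA (A u).
  rewrite -(@ler_pXn2r _ 2) ?nnegrE ?hnorm_ge0// => h2.
  rewrite -(@ler_pXn2r _ 2) ?nnegrE ?hnorm_ge0//.
  move: h; rewrite /B sqr_hnormB -(sA u u) (operB _ _ lA) hdotBl !hdotBr.
  rewrite (sA (A u) u) !raddfB /= -sqr_hnorm.
  have := Re_hdot_le (A (A u)) (A u).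
  have := ReA u; have := hnorm_ge0 (A u); have := hnorm_ge0 (A (A u)); nra.
have [L [sL cL hL]] := contraction_sqrt_limit sB cB.
have lL := adjoint_linear sL; pose S u := u - L u.
have sS : selfadjoint S by move=> u v; rewrite /S hdotBl hdotBr sL.
exists S; split=> //.
- split; first exact: adjoint_linear sS.
  exists 2 => u; apply: le_trans (hnorm_triangle _ _) _; rewrite hnorm_opp.
  by rewrite mulr_natl mulr2n lerD2l.
- move=> u; rewrite hdot_selfadjointE// ler0c /S hdotBl raddfB /= -sqr_hnorm.
  rewrite subr_ge0; apply: le_trans (Re_hdot_le _ _) _.
  by rewrite expr2 ler_wpM2r ?hnorm_ge0.
- move=> u; rewrite /S /= (operB _ _ lL); have := hL u.
  rewrite rmorph_nat scaler_nat mulr2n => h.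
  rewrite opprB addrA addrAC -(addrA u) -opprD h opprD addrA subrK.
  by rewrite /B opprB addrC subrK.
Qed.

(** Dividing by a positive bound M makes A a contraction; its root is then rescaled by the square
    root of M. *)
Lemma positive_sqrt (A : H -> H) :
  bounded_operator A -> selfadjoint A -> positive_operator A ->
  exists S : H -> H, [/\ bounded_operator S, positive_operator S,
    selfadjoint S & S \o S =1 A].
Proof.
move=> /bounded_operator_gt0 [M M0 hM] sA pA; have lA := adjoint_linear sA.
pose A' u := (M^-1)%:C *: A u.
have [||u|S [[lS [K hK]] pS sS SS]] := @contraction_sqrt A'.
- by move=> u v; rewrite /A' hdotZl hdotZr sA conjc_real.
- by move=> u; rewrite /A' hdotZl mulr_ge0// ler0c invr_ge0 ltW.
- have Mi : 0 <= M^-1 by rewrite invr_ge0 ltW.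
  rewrite /A' hnormZr ger0_norm//.
  by rewrite ler_pdivrMl.
exists (fun u => (Num.sqrt M)%:C *: S u); split.
- split; first by move=> c u v; rewrite lS scalerDr !scalerA mulrC.
  exists (Num.sqrt M * K) => u; rewrite hnormZr ger0_norm ?sqrtr_ge0//.
  by rewrite -mulrA ler_wpM2l ?sqrtr_ge0.
- by move=> u; rewrite hdotZl mulr_ge0// ler0c sqrtr_ge0.
- by move=> u v; rewrite hdotZl hdotZr sS conjc_real.
- move=> u /=; rewrite (operZ _ _ lS) scalerA -rmorphM /= -expr2 sqr_sqrtr 1?ltW//.
  by have /= -> := SS u; rewrite /A' scalerA -rmorphM /= divff ?gt_eqF// scale1r.
Qed.

End SquareRoot.

(** * Orthonormal families and Bessel's inequality *)

Section OrthonormalFamilies.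
Variables (R : realType) (H : hilbertType R) (I : eqType) (f : I -> H).
Hypothesis fon : forall i j, '[f i, f j] = (i == j)%:R.
Implicit Types (s t : seq I) (u : H) (c : I -> R[i]).

Lemma orthonormal_hnorm i : hnorm (f i) = 1.
Proof.
apply/eqP; rewrite -(@eqrXn2 _ 2) ?hnorm_ge0// sqr_hnorm fon eqxx expr1n.
by apply/eqP.
Qed.

Lemma orthonormal_coef s c i : uniq s ->
  '[\sum_(j <- s) c j *: f j, f i] = if i \in s then c i else 0.
Proof.
move=> us; rewrite hdot_suml; under eq_bigr do rewrite hdotZl fon.
have [si|si] := boolP (i \in s).
  rewrite (big_rem i)//= eqxx mulr1 big1_seq ?addr0// => j /andP[_].
  by rewrite mem_rem_uniq// => /andP[/negbTE /= -> _]; rewrite mulr0.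
rewrite big1_seq// => j /andP[_ js]; case: eqP => [ji|_]; last by rewrite mulr0.
by rewrite ji in js; rewrite js in si.
Qed.

Lemma orthonormal_sum_hdot s u :
  '[\sum_(j <- s) '[u, f j] *: f j, u]
    = (\sum_(j <- s) Normc.normc '[u, f j] ^+ 2)%:C.
Proof.
rewrite hdot_suml rmorph_sum; apply: eq_bigr => i _.
by rewrite hdotZl (hdotC _ u) -sqr_normcE.
Qed.

Lemma orthonormal_sum_sqr_hnorm s c : uniq s ->
  hnorm (\sum_(j <- s) c j *: f j) ^+ 2 = \sum_(j <- s) Normc.normc (c j) ^+ 2.
Proof.
move=> us; apply: complexI; rewrite -hdotE hdot_sumr rmorph_sum.
apply: eq_big_seq => i si.
by rewrite hdotZr orthonormal_coef// si mulrC -sqr_normcE.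
Qed.

(** Pythagoras for the projection onto the span of the chosen vectors. Nonnegativity of the residue
    yields Bessel, its convergence to 0 yields Parseval. *)
Lemma sqr_hnorm_orthonormal_residue s u : uniq s ->
  hnorm (u - \sum_(j <- s) '[u, f j] *: f j) ^+ 2
    = hnorm u ^+ 2 - \sum_(j <- s) Normc.normc '[u, f j] ^+ 2.
Proof.
move=> us; rewrite sqr_hnormB Re_hdotC orthonormal_sum_hdot.
by rewrite orthonormal_sum_sqr_hnorm//=; ring.
Qed.

Lemma bessel s u : uniq s ->
  \sum_(j <- s) Normc.normc '[u, f j] ^+ 2 <= hnorm u ^+ 2.
Proof.
by move=> us; rewrite -subr_ge0 -sqr_hnorm_orthonormal_residue// sqr_ge0.
Qed.

End OrthonormalFamilies.

(** * Parseval's inequality in a countable orthonormal basis *)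

Lemma nondecreasing_bounded_cauchy (R : realType) (a : nat -> R) (M e : R) :
  {homo a : m p / (m <= p)%N >-> m <= p} -> (forall m, a m <= M) -> 0 < e ->
  exists N : nat, forall m, (N <= m)%N -> a m - a N < e.
Proof.
move=> amono aM e0.
have hs : has_sup (range a).
  split; first by exists (a 0); exists 0.
  by exists M => _ [m _ <-].
have [_ [N _ <-] hN] := sup_adherent e0 hs; exists N => m Nm.
have := sup_upper_bound hs (ex_intro2 _ _ m I erefl : range a (a m)); lra.
Qed.

Section Parseval.
Variables (R : realType) (H : hilbertType R) (I : countType) (E : I -> H).
Hypothesis Eb : orthonormal_basis E.
Implicit Types (u : H) (m p : nat).

(** An increasing exhaustion of [I] by finite sets, by which unordered Fourier expansions become
    sequences of partial sums. *)
Definition initial_seq m : seq I := pmap (@pickle_inv I) (iota 0 m).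

Lemma initial_seq_uniq m : uniq (initial_seq m).
Proof. exact: (pmap_uniq (@pickle_invK I) (iota_uniq 0 m)). Qed.

Lemma initial_seqD m p : exists t, initial_seq (m + p) = initial_seq m ++ t.
Proof. by rewrite /initial_seq iotaD pmap_cat; eexists. Qed.

Lemma mem_initial_seq m i : (pickle i < m)%N -> i \in initial_seq m.
Proof.
move=> im; rewrite mem_pmap; apply/mapP; exists (pickle i).
  by rewrite mem_iota.
by rewrite pickleK_inv.
Qed.

Let Eon := Eb.1.
Let a u m : R := \sum_(j <- initial_seq m) Normc.normc '[u, E j] ^+ 2.
Let w u m : H := \sum_(j <- initial_seq m) '[u, E j] *: E j.

Lemma fourier_sum_mono u : {homo a u : m p / (m <= p)%N >-> m <= p}.
Proof.
move=> m p /subnKC <-; have [t ht] := initial_seqD m (p - m).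
by rewrite /a ht big_cat/= lerDl sumr_ge0// => i _; rewrite sqr_ge0.
Qed.

Lemma fourier_dist u m p : (m <= p)%N -> hnorm (w u p - w u m) ^+ 2 = a u p - a u m.
Proof.
move=> /subnKC <-; have [t ht] := initial_seqD m (p - m).
have := initial_seq_uniq (m + (p - m)); rewrite /a /w ht cat_uniq => /and3P[_ _ ut].
by rewrite !big_cat/= addrAC subrr add0r orthonormal_sum_sqr_hnorm// addrAC subrr add0r.
Qed.

(** Fourier partial sums are Cauchy because their squared norms increase and stay bounded by Bessel.
    Their limit l has the same coefficients as u, so l = u by maximality of the basis. *)
Lemma parseval_le u (e : R) : 0 < e -> exists N : nat, forall m, (N <= m)%N ->
  hnorm u ^+ 2 <= \sum_(j <- initial_seq m) Normc.normc '[u, E j] ^+ 2 + e.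
Proof.
have sqr_lt (v : H) (d : R) : 0 < d -> hnorm v ^+ 2 < d ^+ 2 -> hnorm v < d.
  by move=> d0; rewrite ltr_pXn2r ?nnegrE ?hnorm_ge0// ltW.
have [|l hl] := @hdot_complete R H (w u).
  move=> d d0; have d20 : 0 < (d / 2) ^+ 2 by rewrite exprn_gt0// divr_gt0.
  have [N hN] := nondecreasing_bounded_cauchy (@fourier_sum_mono u)
    (fun m => bessel Eon u (initial_seq_uniq m)) d20.
  have hw m : (N <= m)%N -> hnorm (w u m - w u N) < d / 2.
    by move=> Nm; apply: sqr_lt; rewrite ?divr_gt0// fourier_dist// hN.
  exists N => m p Nm Np; apply: le_lt_trans (hnorm_triangleB _ (w u N) _) _.
  by rewrite [ltRHS]splitr ltrD ?hw// hnorm_sub hw.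
have lu : u = l.
  apply/eqP; rewrite -subr_eq0; apply/eqP/Eb.2 => i.
  apply/Normc.eq0_normc/eqP; rewrite eq_le normc_ge0 andbT.
  apply/ler_addgt0Pl => d d0; rewrite addr0; have [N hN] := hl d d0.
  (* Past the code of i the partial sum has the same coefficient at i as u; the successor makes the
     inequality on codes strict. *)
  pose m := maxn N (pickle i).+1.
  have -> : '[u - l, E i] = '[w u m - l, E i].
    rewrite !hdotBl; congr (_ - _); rewrite /w orthonormal_coef//.
      by rewrite mem_initial_seq// leq_max ltnSn orbT.
    exact: initial_seq_uniq.
  apply: le_trans (hdot_cauchy_schwarz _ _) _.
  by rewrite (orthonormal_hnorm Eon) mulr1; apply/ltW/hN; rewrite leq_maxl.
move=> e0; have e'0 : 0 < Num.sqrt e by rewrite sqrtr_gt0.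
have [N hN] := hl _ e'0; exists N => m Nm; rewrite -lerBlDl.
rewrite -sqr_hnorm_orthonormal_residue ?initial_seq_uniq//.
rewrite -[leRHS](sqr_sqrtr (ltW e0)) ler_pXn2r ?nnegrE ?hnorm_ge0 ?sqrtr_ge0//.
apply: ltW; rewrite hnorm_sub {2}lu; exact: hN.
Qed.

(** A common truncation for finitely many vectors, so that two finite sums can be exchanged in the
    trace estimate. *)
Lemma parseval_sum_le (r : seq H) (e : R) : 0 < e -> exists N : nat,
  forall m, (N <= m)%N ->
  \sum_(v <- r) hnorm v ^+ 2
    <= \sum_(v <- r) \sum_(j <- initial_seq m) Normc.normc '[v, E j] ^+ 2 + e.
Proof.
elim: r e => [|v r IH] e e0.
  by exists 0 => m _; rewrite !big_nil add0r ltW.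
have e20 : 0 < e / 2 by rewrite divr_gt0.
have [N1 h1] := IH _ e20; have [N2 h2] := parseval_le v e20.
exists (maxn N1 N2) => m; rewrite geq_max => /andP[m1 m2].
by rewrite !big_cons; have := h1 m m1; have := h2 m m2; lra.
Qed.

End Parseval.

(** * Traces and a criterion for trace class *)

Section TraceClassCriterion.
Variables (R : realType) (H : hilbertType R).

(* With S the square root of P, both Tr_f(P) and Tr_E(P) are the sum of all
   |<S f_j, E_i>|^2, so the bound obtained in the basis E holds in any other. *)
Lemma positive_trace_le (I : countType) (E : I -> H) (P : H -> H) (C : R)
    (J : choiceType) (f : J -> H) :
  orthonormal_basis E ->
  bounded_operator P -> selfadjoint P -> positive_operator P ->
  (forall s : seq I, uniq s -> \sum_(i <- s) hnorm (P (E i)) <= C) ->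
  orthonormal_basis f ->
  (op_trace f P <= C%:E)%E.
Proof.
move=> Eb bP sP pP hC [fon _]; have [S [_ _ sS SS]] := positive_sqrt bP sP pP.
have PE u : complex.Re '[P u, u] = hnorm (S u) ^+ 2.
  by rewrite sqr_hnorm -sS; have /= -> := SS u.
have hr (r : seq J) : uniq r -> \sum_(j <- r) complex.Re '[P (f j), f j] <= C.
  move=> ur; apply/ler_addgt0Pr => e e0.
  have [N hN] := parseval_sum_le Eb [seq S (f j) | j <- r] e0.
  under eq_bigr do rewrite PE.
  have := hN N (leqnn N); rewrite !big_map => /le_trans; apply.
  rewrite lerD2r exchange_big/=; apply: le_trans (hC _ (initial_seq_uniq I N)).
  (* For each i, Bessel over f bounds the inner sum by |S E_i|^2, which is <P E_i, E_i> and hence at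
     most |P E_i|. *)
  apply: ler_sum => i _; apply: (@le_trans _ _ (hnorm (S (E i)) ^+ 2)).
    apply: le_trans (bessel fon (S (E i)) ur); apply: ler_sum => j _.
    by rewrite (sS (f j)) normc_hdotC.
  rewrite -PE; apply: le_trans (Re_hdot_le _ _) _.
  by rewrite (orthonormal_hnorm Eb.1) mulr1.
rewrite /op_trace /esum; apply: ge_ereal_sup => _ [A [finA _] <-].
rewrite sumEFin lee_fin; apply: hr; exact: finite_support_uniq.
Qed.

(** Take P to be the square root of T' T. Then |P u|^2 = <T' T u, u> = |T u|^2, so the summability
    of T on the basis is that of P. *)
Lemma trace_class_summable (I : countType) (E : I -> H) (T T' : H -> H) (C : R) :
  orthonormal_basis E ->
  bounded_operator T -> bounded_operator T' -> adjoint T T' ->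
  (forall s : seq I, uniq s -> \sum_(i <- s) hnorm (T (E i)) <= C) ->
  trace_class T.
Proof.
move=> Eb bT bT' TT' hC; split=> //; pose A u := T' (T u).
have T'T := adjoint_sym TT'.
have sA : selfadjoint A by move=> u v; rewrite /A T'T TT'.
have pA : positive_operator A by move=> u; rewrite /A T'T hdot_ge0.
have bA : bounded_operator A.
  split; first exact: adjoint_linear sA.
  have [M1 M10 h1] := bounded_operator_gt0 bT'.
  have [M2 _ h2] := bounded_operator_gt0 bT.
  exists (M1 * M2) => u; apply: le_trans (h1 _) _.
  by rewrite -mulrA ler_wpM2l// ltW.
have [P [bP pP sP PP]] := positive_sqrt bA sA pA.
have PT u : hnorm (P u) = hnorm (T u).
  apply/eqP; rewrite -(@eqrXn2 _ 2) ?hnorm_ge0// !sqr_hnorm -sP -T'T.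
  by have /= -> := PP u.
exists P; first by split=> //; exists T'.
move=> J f fb; apply: le_lt_trans (ltry C).
apply: (positive_trace_le Eb) => // s us.
by under eq_bigr do rewrite PT; exact: hC.
Qed.

End TraceClassCriterion.

(** * Compositions, commutators and uniqueness of adjoints *)

Section OperatorClosure.
Variables (R : realType) (H : hilbertType R).
Implicit Types (T S : H -> H) (u v : H).

Lemma bounded_operator_comp T S :
  bounded_operator T -> bounded_operator S -> bounded_operator (T \o S).
Proof.
move=> bT bS; split.
  by move=> c u v; rewrite /= bS.1 bT.1.
have [M1 M10 h1] := bounded_operator_gt0 bT.
have [M2 _ h2] := bounded_operator_gt0 bS.
exists (M1 * M2) => u /=; apply: le_trans (h1 _) _.
by rewrite -mulrA ler_wpM2l// ltW.
Qed.

Lemma bounded_operator_sub T S : bounded_operator T -> bounded_operator S ->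
  bounded_operator (fun u => T u - S u).
Proof.
move=> [lT [M1 h1]] [lS [M2 h2]]; split.
  by move=> c u v; rewrite lT lS scalerBr opprD addrACA.
exists (M1 + M2) => u; apply: le_trans (hnorm_triangle _ _) _.
by rewrite hnorm_opp mulrDl lerD.
Qed.

Lemma bounded_operator_commutator T S : bounded_operator T ->
  bounded_operator S -> bounded_operator (op_commutator T S).
Proof.
by move=> bT bS; apply: bounded_operator_sub; apply: bounded_operator_comp.
Qed.

Lemma adjoint_commutator T T' S S' : adjoint T T' -> adjoint S S' ->
  adjoint (op_commutator T S) (op_commutator S' T').
Proof.
by move=> TT' SS' u v; rewrite /op_commutator hdotBl hdotBr TT' !SS' TT'.
Qed.

Lemma adjoint_eq T S T' : adjoint T T' -> adjoint S T' -> T =1 S.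
Proof.
move=> TT' ST' u; apply: hdot_eqr => w.
by rewrite -(adjoint_sym TT') -(adjoint_sym ST').
Qed.

Lemma adjoint_eqr T T' S' : adjoint T T' -> adjoint T S' -> T' =1 S'.
Proof. by move=> TT' TS' u; apply: hdot_eqr => w; rewrite -TT' -TS'. Qed.

(** For each v the vector T' v - S' v is orthogonal to every e_i, hence 0 by maximality; so T and S
    share an adjoint. *)
Lemma orthonormal_basis_ext (I : eqType) (e : I -> H) T T' S S' :
  orthonormal_basis e -> adjoint T T' -> adjoint S S' ->
  (forall i, T (e i) = S (e i)) -> T =1 S.
Proof.
move=> [_ emax] TT' SS' TS; apply: (adjoint_eq TT') => u v.
suff -> : T' v = S' v by exact: SS'.
apply/eqP; rewrite -subr_eq0; apply/eqP/emax => i.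
by rewrite hdotC hdotBr -TT' -SS' TS subrr conjc0.
Qed.

End OperatorClosure.

(** * Direct sums of Hilbert spaces and of representations *)

Section DirectSumOperators.
Variables (R : realType) (H K : hilbertType R).
Implicit Types (w : H * K).

Lemma sum_hdotE (u v : H * K) : '[u, v] = '[u.1, v.1] + '[u.2, v.2].
Proof. by []. Qed.

Lemma sum_sqr_hnorm w : hnorm w ^+ 2 = hnorm w.1 ^+ 2 + hnorm w.2 ^+ 2.
Proof. by rewrite !sqr_hnorm sum_hdotE raddfD. Qed.

Lemma sum_hnorm_le w : hnorm w <= hnorm w.1 + hnorm w.2.
Proof.
rewrite -(@ler_pXn2r _ 2) ?nnegrE ?addr_ge0 ?hnorm_ge0// sum_sqr_hnorm.
by rewrite sqrrD lerD2r lerDl mulrn_wge0// mulr_ge0 ?hnorm_ge0.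
Qed.

Lemma hnorm_fst_le w : hnorm w.1 <= hnorm w.
Proof.
by rewrite -(@ler_pXn2r _ 2) ?nnegrE ?hnorm_ge0// sum_sqr_hnorm lerDl sqr_ge0.
Qed.

Lemma hnorm_snd_le w : hnorm w.2 <= hnorm w.
Proof.
by rewrite -(@ler_pXn2r _ 2) ?nnegrE ?hnorm_ge0// sum_sqr_hnorm lerDr sqr_ge0.
Qed.

Definition sum_basis (I J : Type) (e : I -> H) (f : J -> K) (x : I + J) : H * K :=
  match x with inl i => (e i, 0) | inr j => (0, f j) end.

Lemma sum_basis_orthonormal (I J : eqType) (e : I -> H) (f : J -> K) :
  orthonormal_basis e -> orthonormal_basis f ->
  orthonormal_basis (sum_basis e f).
Proof.
move=> [eon emax] [fon fmax]; split=> [[i|i] [j|j]|w hw].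
- by rewrite sum_hdotE /= eon hdot0l addr0.
- by rewrite sum_hdotE /= hdot0l hdot0r addr0.
- by rewrite sum_hdotE /= hdot0l hdot0r addr0.
- by rewrite sum_hdotE /= fon hdot0l add0r.
- case: w hw => u v hw; congr (_, _).
    by apply: emax => i; have := hw (inl i); rewrite sum_hdotE /= hdot0r addr0.
  by apply: fmax => j; have := hw (inr j); rewrite sum_hdotE /= hdot0r add0r.
Qed.

Lemma rep_sum_star_representation (A : starAlgType R)
    (phi : A -> H -> H) (psi : A -> K -> K) :
  star_representation phi -> star_representation psi ->
  star_representation (rep_sum phi psi).
Proof.
move=> [bp p1 pD pZ pM ps] [br r1 rD rZ rM rs]; split.
- move=> a; split.
    by move=> c u v; rewrite /rep_sum /= (bp a).1 (br a).1.
  have [M1 M10 h1] := bounded_operator_gt0 (bp a).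
  have [M2 M20 h2] := bounded_operator_gt0 (br a).
  exists (M1 + M2) => w; apply: le_trans (sum_hnorm_le _) _.
  rewrite mulrDl lerD//=.
    by apply: le_trans (h1 _) _; rewrite ler_wpM2l ?hnorm_fst_le// ltW.
  by apply: le_trans (h2 _) _; rewrite ler_wpM2l ?hnorm_snd_le// ltW.
- by move=> [u v]; rewrite /rep_sum /= p1 r1.
- by move=> a b [u v]; rewrite /rep_sum /= pD rD.
- by move=> c a [u v]; rewrite /rep_sum /= pZ rZ.
- by move=> a b [u v]; rewrite /rep_sum /= pM rM.
- by move=> a u v; rewrite !sum_hdotE /= ps rs.
Qed.

End DirectSumOperators.

(** * The operators F and gamma *)

Section FlipGrading.
Variables (R : realType) (H : hilbertType R).

Lemma flip_selfadjoint : selfadjoint (@flip R H).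
Proof. by move=> u v; rewrite !sum_hdotE addrC. Qed.

Lemma flip_bounded : bounded_operator (@flip R H).
Proof.
split; first by move=> c [u1 u2] [v1 v2].
exists 1 => w; rewrite mul1r -(@ler_pXn2r _ 2) ?nnegrE ?hnorm_ge0//.
by rewrite !sum_sqr_hnorm addrC.
Qed.

Lemma diag_grading_selfadjoint : selfadjoint (@diag_grading R H).
Proof. by move=> u v; rewrite !sum_hdotE /= hdotNl hdotNr. Qed.

Lemma diag_grading_bounded : bounded_operator (@diag_grading R H).
Proof.
split; first exact: adjoint_linear diag_grading_selfadjoint.
exists 1 => w; rewrite mul1r -(@ler_pXn2r _ 2) ?nnegrE ?hnorm_ge0//.
by rewrite !sum_sqr_hnorm /= hnorm_opp.
Qed.

End FlipGrading.

(** * Summability of r^(k_0 + ... + k_(n-1)) over multi-indices *)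

Lemma sum_seq_le_codom (R : realDomainType) (I : eqType) (J : finType)
    (g : J -> I) (F : I -> R) (s : seq I) :
  (forall i, 0 <= F i) -> uniq s -> (forall i, i \in s -> exists j, i = g j) ->
  \sum_(i <- s) F i <= \sum_j F (g j).
Proof.
(* A list of preimages of [s] is again duplicate-free, so the left side is a partial sum of the
   right one, whose other terms are nonnegative. *)
move=> F0 us sg; have [t st] : exists t, s = map g t.
  elim: s {us} sg => [|i s IH] sg; first by exists [::].
  have [|t ->] := IH; first by move=> j js; apply: sg; rewrite inE js orbT.
  by have [j ->] := sg i (mem_head _ _); exists (j :: t).
rewrite st big_map; have ut : uniq t by apply: (@map_uniq _ _ g); rewrite -st.
rewrite (big_uniq _ ut) /= [leRHS](bigID (mem t)) /= lerDl.
by rewrite sumr_ge0.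
Qed.

Lemma geometric_sum_le (R : realFieldType) (r : R) N : 0 <= r < 1 ->
  \sum_(m < N) r ^+ m <= (1 - r)^-1.
Proof.
move=> /andP[r0 r1]; have r10 : 0 < 1 - r by rewrite subr_gt0.
rewrite -[leRHS]mul1r ler_pdivlMr//.
have := subrX1 r N; have : 0 <= r ^+ N by rewrite exprn_ge0.
by move: (r ^+ N) (\sum_(m < N) _) => a b; lra.
Qed.

(** Each copy of the index set contributes (1 - r)^-n, whence the 2. A finite list lies in a box,
    over which the sum is a product of n truncated geometric series. *)
Lemma multi_index_sum_le (R : realFieldType) (r : R) (n : nat)
    (s : seq (multi_index n + multi_index n)) : 0 <= r < 1 -> uniq s ->
  \sum_(x <- s) r ^+ (\sum_j (match x with inl k | inr k => k end) j)
    <= 2 * (1 - r)^-1 ^+ n.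
Proof.
move=> r01 us; have /andP[r0 r1] := r01.
pose ix (x : multi_index n + multi_index n) := match x with inl k | inr k => k end.
(* One more than the largest entry occurring in [s], so that every entry is an element of ['I_N]. *)
pose N := (\max_(x <- s) \max_j ix x j).+1.
pose emb (k : {ffun 'I_n -> 'I_N}) : multi_index n := [ffun j => val (k j)].
pose g (x : {ffun 'I_n -> 'I_N} + {ffun 'I_n -> 'I_N}) :=
  match x with inl k => inl (emb k) | inr k => inr (emb k) end.
have embP k x : x \in s -> k = ix x -> exists k', k = emb k'.
  move=> xs kx; exists [ffun j => inord (k j)]; apply/ffunP => j.
  rewrite !ffunE /= inordK// ltnS kx.
  by rewrite (leq_trans (leq_bigmax j))// (leq_bigmax_seq _ xs).
apply: le_trans (@sum_seq_le_codom _ _ _ g _ s _ us _) _.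
- by move=> x; rewrite exprn_ge0.
- move=> [k|k] xs.
    by have [k' ->] := embP k _ xs erefl; exists (inl k').
  by have [k' ->] := embP k _ xs erefl; exists (inr k').
have h : \sum_(k : {ffun 'I_n -> 'I_N}) r ^+ (\sum_j (emb k) j)
    <= (1 - r)^-1 ^+ n.
  have -> : \sum_(k : {ffun 'I_n -> 'I_N}) r ^+ (\sum_j (emb k) j)
      = \prod_(j < n) \sum_(m < N) r ^+ m.
    rewrite bigA_distr_bigA; apply: eq_bigr => k _.
    by rewrite -prodrXr; apply: eq_bigr => j _; rewrite ffunE.
  rewrite prodr_const card_ord lerXn2r ?nnegrE ?sumr_ge0//.
  - by move=> m _; rewrite exprn_ge0.
  - by rewrite invr_ge0 subr_ge0 ltW.
  - exact: geometric_sum_le.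
by rewrite big_sumType /= mulr_natl mulr2n lerD.
Qed.

(** * The difference of the two sphere representations *)

Lemma star1 (R : rcfType) (A : starAlgType R) : star (1 : A) = 1.
Proof. by rewrite -[LHS]mul1r -{1}(starK 1) -starM mul1r starK. Qed.

Section SphereDifference.
Variables (R : realType) (n : nat) (q : R) (H : hilbertType R).
Variables (e : multi_index n -> H) (psi_plus psi_minus : qsphere n q -> H -> H).
Hypotheses (hq : 1 < `|q|) (he : orthonormal_basis e).
Hypotheses (hplus : sphere_representation 1 e psi_plus)
  (hminus : sphere_representation (-1) e psi_minus).
Implicit Types (a b c : qsphere n q) (u v : H) (i : 'I_n).

Let q0 : q != 0.
Proof. by apply: contraTneq hq => ->; rewrite normr0 ltr10. Qed.

Let rp := sphere_rep_star hplus.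
Let rm := sphere_rep_star hminus.

Local Notation x0 := (@qs_gen R n q ord0).
Local Notation x i := (@qs_gen R n q (lift ord0 i)).
Local Notation X := (psi_plus x0).

Definition rep_difference a u := psi_plus a u - psi_minus a u.
Local Notation D := rep_difference.

Lemma sphere_star_x0 : star x0 = x0.
Proof. by rewrite -(sphere_x0_selfadjoint (qsphere_gen_rel n q)). Qed.

Lemma sphere_x0_comm i : x0 * x i = q%:C *: (x i * x0).
Proof. by apply: (sphere_xx (qsphere_gen_rel n q)); rewrite lift0. Qed.

Lemma sphere_x0_star_comm i : x0 * star (x i) = (q^-1)%:C *: (star (x i) * x0).
Proof.
have -> : star (x i) * x0 = q%:C *: (x0 * star (x i)).
  by apply: (sphere_sx (qsphere_gen_rel n q)).
by rewrite scalerA -rmorphM /= mulVf// scale1r.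
Qed.

Lemma sphere_minus_x0 u : psi_minus x0 u = - X u.
Proof.
apply: (@orthonormal_basis_ext _ _ _ e _ (psi_minus (star x0)) (fun v => - X v)
  (fun v => - psi_plus (star x0) v) he).
- exact: rep_star rm _.
- by move=> v w; rewrite hdotNl hdotNr (rep_star rp).
- move=> k; rewrite (sphere_rep_x0 hminus) (sphere_rep_x0 hplus).
  by rewrite mul1r mulN1r rmorphN scaleNr.
Qed.

Lemma sphere_minus_xi i : psi_minus (x i) =1 psi_plus (x i).
Proof.
apply: (orthonormal_basis_ext he (rep_star rm _) (rep_star rp _)) => k.
by rewrite (sphere_rep_xi hminus) (sphere_rep_xi hplus).
Qed.

Lemma sphere_minus_star_xi i : psi_minus (star (x i)) =1 psi_plus (star (x i)).
Proof.
apply: (adjoint_eqr (rep_star rm _)) => u v.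
by rewrite sphere_minus_xi (rep_star rp).
Qed.

(* The bound on X (psi_minus a u) is what makes the bound on D stable under
   products. *)
Definition x0_dominated a := exists2 M : R, 0 <= M &
  forall u, hnorm (X (psi_minus a u)) <= M * hnorm (X u) /\
            hnorm (D a u) <= M * hnorm (X u).

(** As psi_minus x0 = - X, moving x0 past a gives X (psi_minus a u) = c psi_minus a (X u). The unit,
    the x_i with i >= 1 and their adjoints are of this type. *)
Lemma x0_dominated_comm a (c : R[i]) :
  x0 * a = c *: (a * x0) -> (forall u, D a u = 0) -> x0_dominated a.
Proof.
move=> hc Da; have [M M0 hM] := bounded_operator_gt0 (rep_bounded rm a).
exists (Normc.normc c * M) => [|u]; first by rewrite mulr_ge0 ?normc_ge0 1?ltW.
split; last by rewrite Da hnorm0 !mulr_ge0 ?normc_ge0 ?hnorm_ge0 1?ltW.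
have -> : X (psi_minus a u) = - (c *: psi_minus a (psi_minus x0 u)).
  have := repM rm x0 a u; rewrite hc (repZ rm) (repM rm) /= => ->.
  by rewrite sphere_minus_x0 opprK.
rewrite hnorm_opp hnormZ -mulrA ler_wpM2l ?normc_ge0//.
by apply: le_trans (hM _) _; rewrite sphere_minus_x0 hnorm_opp.
Qed.

(** The two representations are opposite on x0, so [D x0] is 2 X. This gives the 2 in the constant M
    + 2, while M bounds X. *)
Lemma x0_dominated_x0 : x0_dominated x0.
Proof.
have [M M0 hM] := bounded_operator_gt0 (rep_bounded rp x0).
exists (M + 2) => [|u]; first by rewrite addr_ge0 ?ltW.
rewrite /rep_difference sphere_minus_x0 opprK mulrDl; split.
  rewrite (operN _ (rep_bounded rp x0).1) hnorm_opp; apply: le_trans (hM _) _.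
  by rewrite lerDl mulr_ge0 ?hnorm_ge0.
apply: le_trans (hnorm_triangle _ _) _; rewrite mulr_natl mulr2n lerDr.
by rewrite mulr_ge0 ?hnorm_ge0 ?ltW.
Qed.

Lemma x0_dominated1 : x0_dominated 1.
Proof.
apply: (@x0_dominated_comm _ 1); first by rewrite scale1r mulr1 mul1r.
by move=> u; rewrite /rep_difference (rep1 rp) (rep1 rm) subrr.
Qed.

Lemma x0_dominatedD a b : x0_dominated a -> x0_dominated b -> x0_dominated (a + b).
Proof.
move=> [M M0 hM] [N N0 hN]; exists (M + N) => [|u]; first exact: addr_ge0.
have [h1 h2] := hM u; have [h3 h4] := hN u; rewrite mulrDl; split.
  rewrite (repD rm) (operD _ _ (rep_bounded rp x0).1).
  by apply: le_trans (hnorm_triangle _ _) _; exact: lerD.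
rewrite /rep_difference (repD rp) (repD rm) opprD addrACA.
by apply: le_trans (hnorm_triangle _ _) _; exact: lerD.
Qed.

Lemma x0_dominatedZ (c : R[i]) a : x0_dominated a -> x0_dominated (c *: a).
Proof.
move=> [M M0 hM]; exists (Normc.normc c * M) => [|u].
  by rewrite mulr_ge0 ?normc_ge0.
have [h1 h2] := hM u; rewrite -mulrA; split.
  rewrite (repZ rm) (operZ _ _ (rep_bounded rp x0).1) hnormZ.
  by rewrite ler_wpM2l ?normc_ge0.
by rewrite /rep_difference (repZ rp) (repZ rm) -scalerBr hnormZ ler_wpM2l ?normc_ge0.
Qed.

Lemma x0_dominatedM a b : x0_dominated a -> x0_dominated b -> x0_dominated (a * b).
Proof.
move=> [M M0 hM] [N N0 hN].
have [K K0 hK] := bounded_operator_gt0 (rep_bounded rp a).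
(* M N bounds [D a] after [psi_minus b], and K N bounds [psi_plus a] after [D b]. *)
exists (M * N + K * N) => [|u].
  by rewrite addr_ge0 ?mulr_ge0// ltW.
have [h3 h4] := hN u; have [h1 h2] := hM (psi_minus b u).
have MN : M * hnorm (X (psi_minus b u)) <= M * N * hnorm (X u).
  by rewrite -mulrA ler_wpM2l.
rewrite mulrDl; split.
  rewrite (repM rm) /=; apply: le_trans h1 _; apply: le_trans MN _.
  by rewrite lerDl !mulr_ge0 ?hnorm_ge0// ltW.
have -> : D (a * b) u = D a (psi_minus b u) + psi_plus a (D b u).
  rewrite {2}/rep_difference (operB _ _ (rep_bounded rp a).1) /rep_difference (repM rp) (repM rm) /=.
  by rewrite [RHS]addrC subrKA.
apply: le_trans (hnorm_triangle _ _) _; apply: lerD; first exact: le_trans h2 MN.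
by apply: le_trans (hK _) _; rewrite -mulrA ler_wpM2l// ltW.
Qed.

Lemma sphere_x0_dominated a : x0_dominated a.
Proof.
(* Domination is not visibly preserved by [star], so the induction carries [a] and [star a]
   together. *)
suff : x0_dominated a /\ x0_dominated (star a) by case.
elim/qsphere_ind: a => [j||a b [a1 a2] [b1 b2]|c a [a1 a2]|a b [a1 a2] [b1 b2]|a [a1 a2]].
- case: (unliftP ord0 j) => [i|] ->; last first.
    by split; [|rewrite sphere_star_x0]; exact: x0_dominated_x0.
  split.
    apply: x0_dominated_comm (sphere_x0_comm i) _ => u.
    by rewrite /rep_difference sphere_minus_xi subrr.
  apply: x0_dominated_comm (sphere_x0_star_comm i) _ => u.
  by rewrite /rep_difference sphere_minus_star_xi subrr.
- by split; [|rewrite star1]; exact: x0_dominated1.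
- by split; [|rewrite starD]; exact: x0_dominatedD.
- by split; [|rewrite starZ]; exact: x0_dominatedZ.
- by split; [|rewrite starM]; exact: x0_dominatedM.
- by split; [|rewrite starK].
Qed.

(** On (u, v) the commutator is (- D a v, D a u), so each vector of the doubled basis is sent to one
    of norm |D a e_k|. Domination by X and the geometric series then bound the sum of these
    norms. *)
Lemma sphere_commutator_trace_class a :
  trace_class (op_commutator (@flip R H) (rep_sum psi_plus psi_minus a)).
Proof.
have rs := rep_sum_star_representation rp rm.
have [M M0 hM] := sphere_x0_dominated a.
apply: (trace_class_summable (sum_basis_orthonormal he he)
  (T' := op_commutator (rep_sum psi_plus psi_minus (star a)) (@flip R H))
  (C := M * (2 * (1 - `|q|^-1)^-1 ^+ n))).
- apply: bounded_operator_commutator (rep_bounded rs a); exact: flip_bounded.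
- apply: bounded_operator_commutator (rep_bounded rs _) _; exact: flip_bounded.
- apply: adjoint_commutator (rep_star rs a); exact: flip_selfadjoint.
move=> s us; pose ix (y : multi_index n + multi_index n) :=
  match y with inl k | inr k => k end.
have r01 : 0 <= `|q|^-1 < 1.
  by rewrite invr_ge0 normr_ge0 invf_lt1// (lt_trans ltr01).
apply: (@le_trans _ _ (M * \sum_(y <- s) `|q|^-1 ^+ (\sum_j ix y j))); last first.
  by rewrite ler_wpM2l//; exact: multi_index_sum_le.
rewrite mulr_sumr; apply: ler_sum => y _.
have XE k : hnorm (X (e k)) = `|q|^-1 ^+ (\sum_j k j).
  rewrite (sphere_rep_x0 hplus) mul1r hnormZr (orthonormal_hnorm he.1) mulr1.
  by rewrite normfV normrX exprVn.
have lp := (rep_bounded rp a).1; have lm := (rep_bounded rm a).1.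
apply: (@le_trans _ _ (hnorm (D a (e (ix y))))); last first.
  by rewrite -XE; exact: (hM _).2.
case: y => k; apply: le_trans (sum_hnorm_le _) _;
  rewrite /op_commutator /flip /rep_sum /= (oper0 lp) (oper0 lm) subrr hnorm0.
  by rewrite add0r.
by rewrite addr0 hnorm_sub.
Qed.

End SphereDifference.

Theorem mainTheorem4 (R : realType) (n : nat) (q : R)
    (hn : (1 <= n)%N) (hq : 1 < `|q|)
    (H : hilbertType R) (e : multi_index n -> H) (he : orthonormal_basis e)
    (psi_plus psi_minus : qsphere n q -> H -> H)
    (hplus : sphere_representation 1 e psi_plus)
    (hminus : sphere_representation (-1) e psi_minus) :
  even_1summable_fredholm_module (rep_sum psi_plus psi_minus)
    (@flip R H) (@diag_grading R H) /\
  forall a : qsphere n q,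
    trace_class (op_commutator (@flip R H) (rep_sum psi_plus psi_minus a)).
Proof.
have tc := sphere_commutator_trace_class hq he hplus hminus; split=> //.
have rs := rep_sum_star_representation
  (sphere_rep_star hplus) (sphere_rep_star hminus).
split=> //.
- exact: diag_grading_bounded.
- exact: diag_grading_selfadjoint.
- by move=> [u v]; rewrite /diag_grading /= opprK.
- move=> a [u v]; rewrite /diag_grading /rep_sum /=; congr (_, _).
  by rewrite (operN _ (rep_bounded (sphere_rep_star hminus) a).1).
- exact: flip_bounded.
- exact: flip_selfadjoint.
- by move=> [u v].
- by move=> [u v]; rewrite /diag_grading /flip /=; congr (_, _); rewrite opprK.
Qed.
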